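(* Let $\Theta$, $\mathcal X$, $\mathcal S$ be finite sets, let $\{P_\theta:\theta\in\Theta\}$ be a family of probability distributions on $\mathcal X$, and let $\pi$ be a prior on $\Theta$ with $\pi(\theta)>0$ for every $\theta\in\Theta$. Put $\bar P=\sum_{\theta\in\Theta}\pi(\theta)P_\theta$, $\mathcal X_0=\{x\in\mathcal X:\bar P(x)>0\}$, and, for $x\in\mathcal X_0$, let $\ell(x)=(P_\theta(x):\theta\in\Theta)\in\mathbb R^{\Theta}$ be the likelihood vector of $x$. Assume that for all distinct $x,x'\in\mathcal X_0$ the likelihood vectors $\ell(x)$ and $\ell(x')$ are not proportional. Then every statistic $T:\mathcal X\to\mathcal S$ that is Bayes-risk preserving at $\pi$ is injective on $\mathcal X_0$.
   Context: Two vectors $\ell(x),\ell(x')$ (which are nonzero with nonnegative entries for $x,x'\in\mathcal X_0$) are proportional if $\ell(x)=c\,\ell(x')$ for some scalar $c>0$. A Markov kernel from a finite set $\mathcal Y$ to a finite set $\mathcal Z$ is a function $\kappa(z\mid y)\ge 0$ with $\sum_{z\in\mathcal Z}\kappa(z\mid y)=1$ for every $y\in\mathcal Y$. For a statistic $T:\mathcal X\to\mathcal S$, let $Q_\theta$ be the distribution of $T(X)$ when $X\sim P_\theta$. A finite decision problem consists of a finite action set $\mathcal A$ and a loss function $L:\Theta\times\mathcal A\to[0,\infty)$. A randomized decision rule based on $X$ is a Markov kernel $\delta(a\mid x)$ from $\mathcal X$ to $\mathcal A$; a rule based on $T$ is a Markov kernel $\gamma(a\mid s)$ from $\mathcal S$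 to $\mathcal A$. The corresponding Bayes risks are $$R_X(\pi,L)=\inf_\delta\sum_{\theta,x,a}\pi(\theta)P_\theta(x)\delta(a\mid x)L(\theta,a),\qquad R_T(\pi,L)=\inf_\gamma\sum_{\theta,s,a}\pi(\theta)Q_\theta(s)\gamma(a\mid s)L(\theta,a),$$ where the infima are over all randomized decision rules based on $X$, respectively on $T$. The statistic $T$ is Bayes-risk preserving at $\pi$ if $R_X(\pi,L)=R_T(\pi,L)$ for every finite action set $\mathcal A$ and every loss function $L:\Theta\times\mathcal A\to[0,\infty)$. *)

(* Defs.v *)
From mathcomp Require Import all_boot all_order all_algebra.
From mathcomp Require Import boolp classical_sets reals.

Set Implicit Arguments.
Unset Strict Implicit.
Unset Printing Implicit Defensive.

Import Order.TTheory GRing.Theory Num.Theory.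
Local Open Scope ring_scope.

Definition is_distr (R : realType) (Y : finType) (p : Y -> R) : Prop :=
  (forall y, 0 <= p y) /\ \sum_y p y = 1.

(* [k y z] is the probability kappa(z | y). *)
Definition is_kernel (R : realType) (Y Z : finType) (k : Y -> Z -> R) : Prop :=
  forall y, is_distr (k y).

Definition mixture (R : realType) (Theta X : finType)
    (P : Theta -> X -> R) (pi : Theta -> R) (x : X) : R :=
  \sum_theta pi theta * P theta x.

Definition mixture_support (R : realType) (Theta X : finType)
    (P : Theta -> X -> R) (pi : Theta -> R) : {set X} :=
  [set x | 0 < mixture P pi x].

Definition likelihood (R : realType) (Theta X : finType)
    (P : Theta -> X -> R) (x : X) : Theta -> R :=
  fun theta => P theta x.

Definition proportional (R : realType) (Theta : finType)
    (u v : Theta -> R) : Prop :=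
  exists2 c : R, 0 < c & forall theta, u theta = c * v theta.

Definition statistic_law (R : realType) (Theta X S : finType)
    (P : Theta -> X -> R) (T : X -> S) (theta : Theta) (s : S) : R :=
  \sum_(x | T x == s) P theta x.

Definition risk (R : realType) (Theta Y A : finType)
    (P : Theta -> Y -> R) (pi : Theta -> R) (L : Theta -> A -> R)
    (delta : Y -> A -> R) : R :=
  \sum_theta \sum_y \sum_a pi theta * P theta y * delta y a * L theta a.

(* If [A] is empty and [Y] is not, there is no rule and [inf] returns 0 instead
   of +oo. This does not affect [bayes_risk_preserving]: when [pi] and the
   [P theta] are distributions, [X] and [S] are nonempty, so both risks are the
   infimum of the empty set. *)
Definition bayes_risk (R : realType) (Theta Y A : finType)
    (P : Theta -> Y -> R) (pi : Theta -> R) (L : Theta -> A -> R) : R :=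
  inf [set risk P pi L delta | delta in [set k | is_kernel k]]%classic.

Definition bayes_risk_preserving (R : realType) (Theta X S : finType)
    (P : Theta -> X -> R) (pi : Theta -> R) (T : X -> S) : Prop :=
  forall (A : finType) (L : Theta -> A -> R),
    (forall theta a, 0 <= L theta a) ->
    bayes_risk P pi L = bayes_risk (statistic_law P T) pi L.

(* Main.v *)
Require Import Defs.
From mathcomp Require Import all_boot all_order all_algebra.
From mathcomp Require Import boolp classical_sets reals.
From mathcomp Require Import ring lra.

(** If [T] identified two points [x] and [x'] of the support, a two-action
    problem would reveal the lost information. With two actions the Bayes risk
    is explicit: minimising separately at each observation [y] gives the sum
    over [y] of the smaller of the two expected losses
    ([bayes_risk_two_actions]). Merging observations replaces a sum of minima
    by the minimum of the sums, which can only increase, and does so strictly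
    when two merged observations strictly prefer different actions
    ([sum_min_lt_min_sum]).

    It remains to find a loss for which [x] and [x'] prefer different actions.
    Since their likelihood vectors [u] and [v] are nonzero, nonnegative and not
    proportional, some minor [u i * v j - u j * v i] is positive
    ([not_proportional_minor]). Charging one action [u j + v j] when the
    parameter is [i], and the other [u i + v i] when it is [j], each divided by
    the prior mass of the parameter, makes the difference of the two expected losses
    equal to this minor at [x] and to its opposite at [x']. *)

Set Implicit Arguments.
Unset Strict Implicit.
Unset Printing Implicit Defensive.

Import Order.TTheory GRing.Theory Num.Theory.
Local Open Scope ring_scope.

Lemma inf_attained (R : realType) (E : set R) (m : R) :
  E m -> (forall y, E y -> m <= y) -> inf E = m.
Proof.
move=> Em lbm; apply/eqP; rewrite eq_le; apply/andP; split.
  by apply: ge_inf => //; exists m.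
by apply: lb_le_inf => //; exists m.
Qed.

(** The posterior expected loss of action [a] at the observation [y], before
    normalisation by the marginal probability of [y]. *)
Definition expected_loss (R : realType) (Theta Y A : finType)
    (P : Theta -> Y -> R) (pi : Theta -> R) (L : Theta -> A -> R)
    (y : Y) (a : A) : R :=
  \sum_theta pi theta * P theta y * L theta a.

Lemma risk_expected_loss (R : realType) (Theta Y A : finType)
    (P : Theta -> Y -> R) (pi : Theta -> R) (L : Theta -> A -> R)
    (delta : Y -> A -> R) :
  risk P pi L delta = \sum_y \sum_a delta y a * expected_loss P pi L y a.
Proof.
rewrite /risk exchange_big /=; apply: eq_bigr => y _.
rewrite exchange_big /=; apply: eq_bigr => a _.
by rewrite mulr_sumr; apply: eq_bigr => theta _; ring.
Qed.

(** The rule is free to choose an action at each observation separately, and a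
    convex combination of two numbers is at least their minimum; the rule that
    always takes the cheaper action attains this bound. *)
Lemma bayes_risk_two_actions (R : realType) (Theta Y : finType)
    (P : Theta -> Y -> R) (pi : Theta -> R) (L : Theta -> bool -> R) :
  bayes_risk P pi L =
  \sum_y Num.min (expected_loss P pi L y true) (expected_loss P pi L y false).
Proof.
rewrite /bayes_risk; set f := expected_loss P pi L; apply: inf_attained.
  pose best y := f y true <= f y false.
  exists (fun y a => (a == best y)%:R).
    move=> y; split=> [a|]; first exact: ler0n.
    by rewrite big_bool; case: (best y); rewrite /= ?addr0 ?add0r.
  rewrite risk_expected_loss; apply: eq_bigr => y _.
  rewrite big_bool /= -/f /best; case: leP => _ /=; ring.
move=> _ [delta delta_kernel <-]; rewrite risk_expected_loss.
apply: ler_sum => y _; have [delta_ge0] := delta_kernel y.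
rewrite !big_bool /= -/f => delta_sum1.
rewrite -[leLHS]mul1r -delta_sum1 mulrDl.
by apply: lerD; apply: ler_wpM2l => //; rewrite ge_min lexx ?orbT.
Qed.

Lemma expected_loss_statistic (R : realType) (Theta X S A : finType)
    (P : Theta -> X -> R) (pi : Theta -> R) (L : Theta -> A -> R)
    (T : X -> S) (s : S) (a : A) :
  expected_loss (statistic_law P T) pi L s a =
  \sum_(x | T x == s) expected_loss P pi L x a.
Proof.
rewrite /expected_loss exchange_big /=; apply: eq_bigr => theta _.
by rewrite /statistic_law mulr_sumr mulr_suml.
Qed.

Lemma sum_min_le_min_sum (R : realDomainType) (I : finType) (D : pred I)
    (f g : I -> R) :
  \sum_(i | D i) Num.min (f i) (g i)
    <= Num.min (\sum_(i | D i) f i) (\sum_(i | D i) g i).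
Proof.
by rewrite le_min; apply/andP; split; apply: ler_sum => i _;
  rewrite ge_min lexx ?orbT.
Qed.

Lemma sum_min_lt_min_sum (R : realDomainType) (I : finType) (D : pred I)
    (f g : I -> R) (i j : I) :
  D i -> D j -> g i < f i -> f j < g j ->
  \sum_(k | D k) Num.min (f k) (g k)
    < Num.min (\sum_(k | D k) f k) (\sum_(k | D k) g k).
Proof.
move=> Di Dj gf fg; rewrite lt_min; apply/andP; split.
  rewrite (bigD1 i) // [ltRHS](bigD1 i) //=.
  apply: ltr_leD; first by rewrite gt_min gf orbT.
  by apply: ler_sum => k _; rewrite ge_min lexx.
rewrite (bigD1 j) // [ltRHS](bigD1 j) //=.
apply: ltr_leD; first by rewrite gt_min fg.
by apply: ler_sum => k _; rewrite ge_min lexx orbT.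
Qed.

(** Both risks split over the fibres of [T]. Merging cannot lower the
    contribution of any fibre, and it raises that of the fibre through [x] and
    [x'], where no single action is the cheaper one throughout. *)
Lemma bayes_risk_statistic_gt (R : realType) (Theta X S : finType)
    (P : Theta -> X -> R) (pi : Theta -> R) (L : Theta -> bool -> R)
    (T : X -> S) (x x' : X) :
  T x = T x' ->
  expected_loss P pi L x false < expected_loss P pi L x true ->
  expected_loss P pi L x' true < expected_loss P pi L x' false ->
  bayes_risk P pi L < bayes_risk (statistic_law P T) pi L.
Proof.
move=> Txx' prefx prefx'; rewrite !bayes_risk_two_actions.
rewrite (partition_big T predT) //= (bigD1 (T x)) // [ltRHS](bigD1 (T x)) //=.
apply: ltr_leD.
  rewrite !expected_loss_statistic.
  by apply: (@sum_min_lt_min_sum _ _ _ _ _ x x'); rewrite ?Txx'.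
apply: ler_sum => s _.
by rewrite !expected_loss_statistic sum_min_le_min_sum.
Qed.

(** Exchanging [i] and [j] negates a minor, so if none is positive they all
    vanish. Summing [u i * v j = u j * v i] over [j] then shows that [u] is [v]
    scaled by the ratio of their total masses. *)
Lemma not_proportional_minor (R : realType) (Theta : finType)
    (u v : Theta -> R) :
  0 < \sum_i u i -> 0 < \sum_i v i -> ~ proportional u v ->
  exists i j, u j * v i < u i * v j.
Proof.
move=> u_gt0 v_gt0 not_prop; apply: contrapT => no_minor; apply: not_prop.
have minor_le i j : u i * v j <= u j * v i.
  by rewrite leNgt; apply/negP => lt_ij; apply: no_minor; exists i, j.
exists ((\sum_i u i) / \sum_i v i) => [|i]; first exact: divr_gt0.
apply: (mulIf (lt0r_neq0 v_gt0)).
rewrite mulrAC divfK ?lt0r_neq0 // mulr_sumr mulr_suml.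
by apply: eq_bigr => j _; apply/eqP; rewrite eq_le !minor_le.
Qed.

(** A point of null likelihood under every parameter has mixture mass zero. *)
Lemma likelihood_sum_gt0 (R : realType) (Theta X : finType)
    (P : Theta -> X -> R) (pi : Theta -> R) (x : X) :
  (forall theta, 0 <= P theta x) -> x \in mixture_support P pi ->
  0 < \sum_theta likelihood P x theta.
Proof.
move=> P_ge0; rewrite inE /mixture => mix_gt0.
rewrite lt_neqAle sumr_ge0 ?andbT => [|theta _]; last exact: P_ge0.
rewrite eq_sym; apply/negP; rewrite psumr_eq0 => [/allP P0|theta _].
  move: mix_gt0; rewrite big1 ?ltxx // => theta _.
  have /eqP := P0 theta (mem_index_enum theta).
  by rewrite /likelihood => ->; rewrite mulr0.
exact: P_ge0.
Qed.

(** Dividing by the prior cancels it from the expected losses, so that only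
    the likelihoods decide between the two actions. *)
Definition two_point_loss (R : realType) (Theta : finType) (pi : Theta -> R)
    (i j : Theta) (a b : R) (theta : Theta) (act : bool) : R :=
  if act then (theta == i)%:R * (a / pi theta)
  else (theta == j)%:R * (b / pi theta).

Lemma expected_two_point_loss (R : realType) (Theta X : finType)
    (P : Theta -> X -> R) (pi : Theta -> R) (i j : Theta) (a b : R)
    (x : X) (act : bool) :
  (forall theta, 0 < pi theta) ->
  expected_loss P pi (two_point_loss pi i j a b) x act =
  if act then a * P i x else b * P j x.
Proof.
move=> pi_gt0.
have single k c :
    \sum_theta pi theta * P theta x * ((theta == k)%:R * (c / pi theta))
    = c * P k x.
  rewrite (bigD1 k) //= eqxx big1 => [|theta /negPf->] /=.
    by field; rewrite lt0r_neq0.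
  by rewrite mul0r mulr0.
by case: act; apply: single.
Qed.

Theorem corollary2 (R : realType) (Theta X S : finType)
    (P : Theta -> X -> R) (pi : Theta -> R)
    (P_distr : forall theta, is_distr (P theta))
    (pi_distr : is_distr pi)
    (pi_gt0 : forall theta, 0 < pi theta)
    (not_prop : forall x x' : X,
       x \in mixture_support P pi -> x' \in mixture_support P pi -> x <> x' ->
       ~ proportional (likelihood P x) (likelihood P x'))
    (T : X -> S) (T_preserving : bayes_risk_preserving P pi T) :
  {in mixture_support P pi &, injective T}.
Proof.
move=> x x' x_supp x'_supp Txx'; apply: contrapT => neq_xx'.
have P_ge0 theta y : 0 <= P theta y by have [] := P_distr theta.
have [i [j]] := not_proportional_minor
  (likelihood_sum_gt0 (P_ge0^~ x) x_supp)
  (likelihood_sum_gt0 (P_ge0^~ x') x'_supp)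
  (not_prop _ _ x_supp x'_supp neq_xx').
rewrite /likelihood => minor_gt0.
(* The terms [P i x * P j x] and [P i x' * P j x'] cancel when the two expected
   losses are compared at [x] and at [x'], leaving the minor in both cases. *)
pose L := two_point_loss pi i j (P j x + P j x') (P i x + P i x').
have L_ge0 theta act : 0 <= L theta act.
  by case: act; rewrite mulr_ge0 ?ler0n // divr_ge0 ?addr_ge0 // ltW.
have := T_preserving _ L L_ge0; apply/eqP; rewrite lt_eqF //.
by apply: (bayes_risk_statistic_gt Txx'); rewrite !expected_two_point_loss //;
  nra.
Qed.
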